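(* Let $G$ be a Hausdorff FSIN topological group. Then every countable left uniformly discrete subset $A\subseteq G$ is right thin. Explicitly, for every identity neighbourhood $V$ of $G$ there is an identity neighbourhood $U$ of $G$ such that $a^{-1}Ua\subseteq V$ for all $a\in A$.
   Context: Let $G$ be a topological group with identity $e$; an identity neighbourhood is a member of the neighbourhood filter $\mathcal N_G(e)$ of $e$. The left (respectively right) uniformity of $G$ is generated by the entourages $\{(x,y)\in G\times G: x^{-1}y\in V\}$ (respectively $\{(x,y)\in G\times G: xy^{-1}\in V\}$), where $V$ ranges over $\mathcal N_G(e)$. A function $f:G\to\mathbb R$ is left (right) uniformly continuous if it is uniformly continuous with respect to the left (right) uniformity. $G$ is FSIN (functionally balanced) if every bounded left uniformly continuous function $f:G\to\mathbb R$ is right uniformly continuous. A subset $A\subseteq G$ is left uniformly discrete if there is $O\in\mathcal N_G(e)$ such that the sets $aO$, $a\in A$, are pairwise disjoint. A subset $A\subseteq G$ is right thin if for every $V\in\mathcal N_G(e)$ there is $U\in\mathcal N_G(e)$ such that $a^{-1}Ua\subseteq V$ for all $a\in A$. *)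

(* Defs.v *)
From HB Require Import structures.
From mathcomp Require Import all_boot all_order all_algebra.
From mathcomp Require Import all_classical all_reals all_analysis.
Import numFieldNormedType.Exports.

Set Implicit Arguments.
Unset Strict Implicit.
Unset Printing Implicit Defensive.

Local Open Scope classical_set_scope.
Local Open Scope group_scope.

HB.mixin Record isTopologicalGroup G & Topological G & Group G := {
  mulg_continuous : continuous (fun x : G * G => x.1 * x.2);
  invg_continuous : continuous (fun x : G => x^-1);
}.

#[short(type="topologicalGroupType")]
HB.structure Definition TopologicalGroup :=
  {G of Topological G & Group G & isTopologicalGroup G}.

Section TopologicalGroupTheory.
Variable G : topologicalGroupType.

Lemma nbhs1_inv (V : set G) : nbhs (1 : G) V -> nbhs (1 : G) [set x | V x^-1].
Proof. by move=> V1; apply: (@invg_continuous G 1); rewrite invg1. Qed.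

Lemma nbhs1_mul (V : set G) : nbhs (1 : G) V ->
  exists2 W, nbhs (1 : G) W & forall x y, W x -> W y -> V (x * y).
Proof.
move=> V1; have : nbhs ((1, 1) : G * G) [set x : G * G | V (x.1 * x.2)].
  by apply: (@mulg_continuous G (1, 1)); rewrite /= mulg1.
move=> [[/= A B] [A1 B1] ABV]; exists (A `&` B); first exact: filterI.
by move=> x y [Ax _] [_ By]; exact: (ABV (x, y)).
Qed.

Lemma mulg_continuousl (a : G) : continuous (fun x : G => a * x).
Proof.
move=> x; apply: (@continuous_comp _ _ _ (fun x => (a, x))
  (fun x : G * G => x.1 * x.2)); last exact: mulg_continuous.
by apply: cvg_pair => /=; [exact: cvg_cst|exact: cvg_id].
Qed.

Lemma mulg_continuousr (a : G) : continuous (fun x : G => x * a).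
Proof.
move=> x; apply: (@continuous_comp _ _ _ (fun x => (x, a))
  (fun x : G * G => x.1 * x.2)); last exact: mulg_continuous.
by apply: cvg_pair => /=; [exact: cvg_id|exact: cvg_cst].
Qed.

Definition left_entourage : set_system (G * G) :=
  filter_from (nbhs (1 : G)) (fun V => [set xy | V (xy.1^-1 * xy.2)]).

Definition right_entourage : set_system (G * G) :=
  filter_from (nbhs (1 : G)) (fun V => [set xy | V (xy.1 * xy.2^-1)]).

Lemma left_entourage_filter : Filter left_entourage.
Proof.
apply: filter_from_filter; first by exists setT; exact: filterT.
by move=> A B A1 B1; exists (A `&` B); first exact: filterI.
Qed.

Lemma right_entourage_filter : Filter right_entourage.
Proof.
apply: filter_from_filter; first by exists setT; exact: filterT.
by move=> A B A1 B1; exists (A `&` B); first exact: filterI.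
Qed.

Lemma left_entourage_diagonal E : left_entourage E -> diagonal `<=` E.
Proof.
move=> [V V1 VE] [x y] xy; apply: VE; rewrite /= -(xy : x = y).
by rewrite mulVg; exact: nbhs_singleton.
Qed.

Lemma right_entourage_diagonal E : right_entourage E -> diagonal `<=` E.
Proof.
move=> [V V1 VE] [x y] xy; apply: VE; rewrite /= -(xy : x = y).
by rewrite mulgV; exact: nbhs_singleton.
Qed.

Lemma left_entourage_inv E : left_entourage E -> left_entourage E^-1%relation.
Proof.
move=> [V V1 VE]; exists [set x | V x^-1]; first exact: nbhs1_inv.
by move=> [x y] /= Vxy; apply: VE => /=; rewrite invgM invgK in Vxy.
Qed.

Lemma right_entourage_inv E :
  right_entourage E -> right_entourage E^-1%relation.
Proof.
move=> [V V1 VE]; exists [set x | V x^-1]; first exact: nbhs1_inv.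
by move=> [x y] /= Vxy; apply: VE => /=; rewrite invgM invgK in Vxy.
Qed.

Lemma left_entourage_split E : left_entourage E ->
  exists2 F, left_entourage F & (F \; F `<=` E)%relation.
Proof.
move=> [V V1 VE]; have [W W1 WV] := nbhs1_mul V1.
exists [set xy | W (xy.1^-1 * xy.2)]; first by exists W.
move=> [x z] /= [y /= Wxy Wyz]; apply: VE => /=.
by rewrite -[x^-1](mulgK y) -mulgA; exact: WV.
Qed.

Lemma right_entourage_split E : right_entourage E ->
  exists2 F, right_entourage F & (F \; F `<=` E)%relation.
Proof.
move=> [V V1 VE]; have [W W1 WV] := nbhs1_mul V1.
exists [set xy | W (xy.1 * xy.2^-1)]; first by exists W.
move=> [x z] /= [y /= Wxy Wyz]; apply: VE => /=.
by rewrite -[x](mulgVK y) -mulgA; exact: WV.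
Qed.

Lemma left_entourage_nbhsE : @nbhs G G = nbhs_ left_entourage.
Proof.
apply/funext => x; apply/seteqP; split => A /=.
  move=> Ax; exists [set xy | A (x * (xy.1^-1 * xy.2))].
    exists [set y | A (x * y)] => //.
    by apply: (@mulg_continuousl x 1); rewrite mulg1.
  by move=> y; rewrite /xsection /= inE /= mulVKg.
move=> [E [V V1 VE] EA]; have : nbhs x [set y | V (x^-1 * y)].
  by apply: (@mulg_continuousl x^-1 x); rewrite mulVg.
by apply: filterS => y Vxy; apply: EA; apply/mem_set; exact: VE.
Qed.

Lemma right_entourage_nbhsE : @nbhs G G = nbhs_ right_entourage.
Proof.
apply/funext => x; apply/seteqP; split => A /=.
  move=> Ax; exists [set xy | A ((xy.1 * xy.2^-1)^-1 * x)].
    exists [set y | A (y^-1 * x)] => //.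
    apply: (@nbhs1_inv [set y | A (y * x)]).
    by apply: (@mulg_continuousr x 1); rewrite mul1g.
  by move=> y; rewrite /xsection /= inE /= invgM invgK mulgVK.
move=> [E [V V1 VE] EA].
have : nbhs x [set y | V (y * x^-1)^-1].
  apply: (@mulg_continuousr x^-1 x [set y | V y^-1]).
  by rewrite mulgV; exact: nbhs1_inv.
apply: filterS => y /= Vxy; apply: EA; apply/mem_set; apply: VE => /=.
by rewrite invgM invgK in Vxy.
Qed.

End TopologicalGroupTheory.

(* [left_uniform G] and [right_uniform G] are copies of the topological space
   [G], carrying the left and the right uniformity respectively. *)
Definition left_uniform (G : topologicalGroupType) : Type := G.
Definition right_uniform (G : topologicalGroupType) : Type := G.

HB.instance Definition _ (G : topologicalGroupType) :=
  Topological.copy (left_uniform G) G.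
HB.instance Definition _ (G : topologicalGroupType) :=
  Nbhs_isUniform_mixin.Build (left_uniform G)
    (@left_entourage_filter G) (@left_entourage_diagonal G)
    (@left_entourage_inv G) (@left_entourage_split G)
    (@left_entourage_nbhsE G).

HB.instance Definition _ (G : topologicalGroupType) :=
  Topological.copy (right_uniform G) G.
HB.instance Definition _ (G : topologicalGroupType) :=
  Nbhs_isUniform_mixin.Build (right_uniform G)
    (@right_entourage_filter G) (@right_entourage_diagonal G)
    (@right_entourage_inv G) (@right_entourage_split G)
    (@right_entourage_nbhsE G).

Definition left_unif_continuous (R : realType) (G : topologicalGroupType)
    (f : G -> R) := unif_continuous (f : left_uniform G -> R).

Definition right_unif_continuous (R : realType) (G : topologicalGroupType)
    (f : G -> R) := unif_continuous (f : right_uniform G -> R).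

Definition FSIN (R : realType) (G : topologicalGroupType) :=
  forall f : G -> R,
    bounded_fun f -> left_unif_continuous f -> right_unif_continuous f.

Definition left_unif_discrete (G : topologicalGroupType) (A : set G) :=
  exists2 O : set G, nbhs (1 : G) O &
    trivIset A (fun a => [set a * o | o in O]).

Definition right_thin (G : topologicalGroupType) (A : set G) :=
  forall V : set G, nbhs (1 : G) V ->
    exists2 U : set G, nbhs (1 : G) U &
      forall a, A a -> [set a^-1 * u * a | u in U] `<=` V.

(* Main.v *)
Require Import Defs.
From mathcomp Require Import all_boot all_order all_algebra.
From mathcomp Require Import all_classical all_reals all_analysis.
Import Order.TTheory GRing.Theory Num.Theory.
Import numFieldNormedType.Exports.

Set Implicit Arguments.
Unset Strict Implicit.
Unset Printing Implicit Defensive.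

Local Open Scope classical_set_scope.
Local Open Scope group_scope.

(** The FSIN hypothesis is used only through sets: if every bounded left
uniformly continuous function is right uniformly continuous, then for every
subset [B] and every identity neighbourhood [V] there is an identity
neighbourhood [U] with [U B] contained in [B V]; apply the hypothesis to a
function that is [0] on [B] and bounded away from [0] outside [B V]
([FSIN_proximally_balanced]).

Left uniform discreteness of [A] provides [O] such that [a^-1 b] is in [O] only
if [a = b].  For a small symmetric [Q] and all [u] near the identity, [u A] is
contained in [A Q], so that each [u a] lies in [p Q] for a unique [p] in [A]:
thus [u] acts on [A] by [a |-> p], and right thinness says that all [u] near
the identity act trivially.  A single set [B] contained in [A] only shows that
the elements near the identity preserve [B]; this leaves room for nontrivial
actions, since every subset of [A] comes with its own neighbourhood.  Two cases
are distinguished, according to whether [G] is locally precompact, which is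
expressed by sequences.

- If every identity neighbourhood contains a sequence [d] that is uniformly
  discrete, fix an injection [r] of [A] into the natural numbers and let [B] be
  the set of the products [a * d i] with [a] in [A] and [i <= r a].  An element
  near the identity which moves [a] to [p] sends the block of [r a + 1] points
  attached to [a] injectively into the block of [p], so [r a <= r p].  Its
  inverse gives the opposite inequality, hence [p = a]
  ([right_thin_scattered]).

- Otherwise some identity neighbourhood [V0] contains no such sequence: in any
  sequence of [V0], two terms differ by an element of a prescribed
  neighbourhood.  If [A] were not right thin, choose inductively elements [u k]
  of [V0] moving some [n k] to [m k <> n k], while fixing all earlier [n i] and
  [m i].  Let [B] be the set of all [n k]; it contains no [m k].  For [k < l]
  the element [(u l)^-1 * u k] moves [n k] to [m k], hence does not preserve
  [B], although for suitable [k < l] it is as close to the identity as desired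
  ([right_thin_recurrent]). *)

(** * Separation by uniformly continuous functions *)

(** The function is the distance to [A], truncated at [e], for the pseudometric
that the gauge of [E] defines. *)
Lemma unif_continuous_separation (R : realType) (T : uniformType)
    (A : set T) (E : set (T * T)) : entourage E ->
  exists (f : T -> R) (e : R), [/\ (0 < e)%R, bounded_fun f,
    unif_continuous f, (forall a, A a -> f a = 0%R) &
    forall x, (f x < e)%R -> exists2 a, A a & E (a, x)].
Proof.
move=> entE.
pose T' : pseudoMetricType R := gauge.type entE.
have [e e0 eE] : exists2 e : R, (0 < e)%R &
    forall x y : T', ball x e y -> E (x, y).
  have : @entourage T' E by exists 0%N => // z [].
  rewrite -entourage_ballE => -[e /= e0 eE].
  by exists e => // x y xy; exact: (eE (x, y)).
(* The infimum of [S x] is the minimum of [e] and of the distance to [A];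
   keeping [e] in the set makes it nonempty even when [A] is empty. *)
pose S (x : T') : set R :=
  [set r | (0 < r)%R /\ ((e <= r)%R \/ exists2 a, A a & ball (a : T') r x)].
pose f x := inf (S x).
have lbS x : has_lbound (S x) by exists 0%R => r [/ltW].
have Se x : S x e by split => //; left.
have f0 x : (0 <= f x)%R.
  by apply: lb_le_inf; [exists e | move=> r [/ltW]].
have fe x : (f x <= e)%R by exact: ge_inf.
have fD x y d : (0 < d)%R -> ball x d y -> (f y - d <= f x)%R.
  move=> d0 xy; apply: lb_le_inf; first by exists e.
  move=> r [r0 rS]; rewrite lerBlDr; apply: ge_inf => //; split.
    exact: addr_gt0.
  case: rS => [er|[a Aa ax]].
    by left; rewrite (le_trans er)// lerDl ltW.
  by right; exists a => //; exact: ball_triangle xy.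
exists f, e; split => //.
- exists e; split; first exact: num_real.
  move=> M eM x _ /=; rewrite ger0_norm//; exact: le_trans (ltW eM).
- move=> D; rewrite -entourage_ballE => -[d /= d0 dD].
  apply: (@gauge.gauge_ent _ _ entE).
  have d2 : (0 < d / 2)%R by rewrite divr_gt0.
  have := @entourage_ball R T' (PosNum d2).
  apply: (@filterS _ _ (@gauge.gauge_filter _ _ entE)) => -[x y] /= xy.
  apply: dD => /=; rewrite /ball /= ltr_distl.
  have h1 := fD _ _ _ d2 xy; have h2 := fD _ _ _ d2 (ball_sym xy).
  have h3 : (d / 2 < d)%R by rewrite ltr_pdivrMr// ltr_pMr// ltr1n.
  apply/andP; split.
    by rewrite (lt_le_trans _ h1)// ltrD2l ltrN2.
  by rewrite -ltrBlDr (lt_le_trans _ h2)// ltrD2l ltrN2.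
- move=> a Aa; apply/eqP; rewrite eq_le f0 andbT.
  apply/ler_addgt0Pr => r r0; rewrite add0r; apply: ge_inf => //.
  by split => //; right; exists a => //; exact: ballxx.
- move=> x /inf_lt - /(_ (ex_intro _ e (Se x))) [r [r0 rS] re].
  case: rS => [er|[a Aa ax]]; first by move: re; rewrite ltNge er.
  by exists a => //; apply: eE; apply: le_ball ax; exact: ltW.
Qed.

(** * Neighbourhoods of the identity and separated sets *)

Section ThinSets.
Variable G : topologicalGroupType.
Implicit Types (A B O Q U V W : set G) (a b u x y : G).

(** A normal form for group words, which decides the identities below. *)
Let gsimp := (@invgM G, @invgK G, @invg1 G, @mulgA G, @mulgK G, @mulgVK G,
  @mulgV G, @mulVg G, @mul1g G, @mulg1 G).

Lemma nbhs1_root V : nbhs (1 : G) V -> exists Q, [/\ nbhs (1 : G) Q,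
  Q 1, forall x, Q x -> Q x^-1 &
  forall x y z t, Q x -> Q y -> Q z -> Q t -> V (x * y * z * t)].
Proof.
move=> /nbhs1_mul[W W1 WV]; have [P P1 PW] := nbhs1_mul W1.
have Q1 : nbhs (1 : G) (P `&` [set x | P x^-1]).
  by apply: filterI => //; exact: nbhs1_inv.
exists (P `&` [set x | P x^-1]); split => //; first exact: nbhs_singleton Q1.
  by move=> x [Px Px'] /=; split => //=; rewrite invgK.
move=> x y z t [Px _] [Py _] [Pz _] [Pt _]; rewrite -(mulgA (x * y)).
by apply: WV; exact: PW.
Qed.

Lemma nbhs1_conj a V : nbhs (1 : G) V -> nbhs (1 : G) [set x | V (a^-1 * x * a)].
Proof.
move=> V1; apply: (@mulg_continuousl G a^-1 1 [set x | V (x * a)]).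
by rewrite mulg1; apply: (@mulg_continuousr G a a^-1); rewrite mulVg.
Qed.

(** Uniform discreteness in a form suited to computation: distinct points of
[A] never differ on the right by an element of [O]. *)
Definition left_separated O A :=
  forall a b, A a -> A b -> O (a^-1 * b) -> a = b.

Lemma left_unif_discrete_separated A : left_unif_discrete A ->
  exists2 O, nbhs (1 : G) O & left_separated O A.
Proof.
case=> O O1 tO; exists O => // a b Aa Ab Oab; apply: tO => //.
exists b; split; first by exists (a^-1 * b) => //; rewrite mulVKg.
by exists 1; [exact: nbhs_singleton | rewrite mulg1].
Qed.

(** That is, [U B] is contained in [B V]: the left and the right uniformity
have the same proximity. *)
Definition proximally_balanced := forall B V, nbhs (1 : G) V ->
  exists2 U, nbhs (1 : G) U &
    forall u b, U u -> B b -> exists2 c, B c & V (c^-1 * u * b).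

(** If [f] vanishes on [B] and is at least [e] outside [B V], right uniform
continuity of [f] keeps [f (u * b)] below [e] for [u] near the identity,
uniformly in [b], which forces [u * b] into [B V]. *)
Lemma FSIN_proximally_balanced (R : realType) : FSIN R G -> proximally_balanced.
Proof.
move=> fsin B V V1.
pose E : set (left_uniform G * left_uniform G) :=
  [set xy | V ((xy.1 : G)^-1 * xy.2)].
have entE : entourage E by exists V.
have [f [e [e0 fb fu fB fE]]] :=
  @unif_continuous_separation R (left_uniform G) B E entE.
have [U U1 Uf] := fsin f fb fu _ (@entourage_ball R _ (PosNum e0)).
exists U => // u b Uu Bb; have := Uf (u * b, b).
rewrite /= mulgK => /(_ Uu); rewrite /ball /= (fB b Bb) subr0 => fube.
have [c Bc Ecub] := fE (u * b) (le_lt_trans (ler_norm _) fube).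
by exists c => //; move: Ecub; rewrite /E /= mulgA.
Qed.

(** * The two cases *)

(** Cardinality turns the action on [A] into a rigid one: since the block of [a]
contains exactly [r a + 1] points, which stay separated after a translation,
no element near the identity can move [a] to a point of smaller rank. *)
Lemma right_thin_scattered A O : proximally_balanced -> countable A ->
  nbhs (1 : G) O -> left_separated O A ->
  (forall V, nbhs (1 : G) V -> exists (d : nat -> G) (W : set G),
    [/\ forall k, V (d k), nbhs (1 : G) W &
        forall k l, (k < l)%N -> ~ W ((d k)^-1 * d l)]) ->
  right_thin A.
Proof.
move=> balG /countable_injP[r r_inj] O1 sepA scatG V V1.
have [Q [Q1 Qe QV Q4]] := nbhs1_root (filterI O1 V1).
have [d [W [dQ /nbhs1_root[P [P1 Pe PV PW]] dW]]] := scatG Q Q1.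
pose B := [set x | exists a i, [/\ A a, (i <= r a)%N & x = a * d i]].
have [UA UA1 UAP] := balG A Q Q1.
have [UB UB1 UBP] := balG B (Q `&` P) (filterI Q1 P1).
have r_le u a p : UB u -> A a -> A p -> Q (p^-1 * u * a) -> (r a <= r p)%N.
  move=> Uu Aa Ap Qpua.
  have hP (i : 'I_(r a).+1) : exists j : 'I_(r p).+1,
      P ((d j)^-1 * (p^-1 * u * a) * d i).
    have Bai : B (a * d i) by exists a, i; rewrite -ltnS ltn_ord.
    have [_ [m [j [Am jm ->]]] [Qj Pj]] := UBP u _ Uu Bai.
    (* Both [a * d i] and [m * d j] differ from their base points by elements of
       [Q], so the block reached by [u * a * d i] is the block of [p]. *)
    have pm : p = m.
      apply: sepA => //; rewrite (_ : p^-1 * m = p^-1 * u * a * d i *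
        (((m * d j)^-1 * u * (a * d i))^-1) * (d j)^-1).
        by apply: (Q4 _ _ _ _ Qpua (dQ i) (QV _ Qj) (QV _ (dQ j))).1.
      by rewrite !gsimp.
    rewrite -pm -ltnS in jm; exists (Ordinal jm) => /=.
    by move: Pj; rewrite -pm !gsimp.
  have [h {}hP] := choice hP.
  have h_le i i' : h i = h i' -> W ((d i)^-1 * d i').
    move=> hii'; have := hP i; have := hP i'; rewrite -hii' => Pi' Pi.
    by have := PW _ _ _ _ (PV _ Pi) Pi' Pe Pe; rewrite !gsimp.
  have h_inj : injective h.
    move=> i i' hii'; apply: val_inj; apply: contrapT => /eqP.
    by rewrite neq_ltn => /orP[] /dW; apply; apply: h_le.
  by have := leq_card h h_inj; rewrite !card_ord.
exists (UA `&` (UB `&` [set u | UB u^-1])).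
  by apply: filterI => //; apply: filterI => //; exact: nbhs1_inv.
move=> a Aa _ [u [UAu [UBu UBu']] <-].
have [p Ap Qp] := UAP u a UAu Aa.
suff pa : p = a.
  by have := (Q4 _ _ _ _ Qp Qe Qe Qe).2; rewrite pa !gsimp.
apply: r_inj; rewrite ?inE//; apply/eqP; rewrite eqn_leq.
rewrite (r_le u a p)// (r_le u^-1 p a)//.
by have := QV _ Qp; rewrite !gsimp.
Qed.

(** A diagonal argument: [u l] fixes [m k] for [k < l], so that [(u l)^-1 * u k]
moves [n k] to [m k] for all [k < l] at once, whereas the recurrence hypothesis
puts one of these elements into the neighbourhood that preserves the set of
all [n k]. *)
Lemma right_thin_recurrent A O V0 : proximally_balanced ->
  nbhs (1 : G) O -> left_separated O A -> nbhs (1 : G) V0 ->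
  (forall d : nat -> G, (forall k, V0 (d k)) -> forall W, nbhs (1 : G) W ->
    exists k l, (k < l)%N /\ W ((d k)^-1 * d l)) ->
  right_thin A.
Proof.
move=> balG O1 sepA V01 recG V V1; apply: contrapT => nthin.
have [Q [Q1 Qe QV Q4]] := nbhs1_root (filterI O1 V1).
have [UA UA1 UAP] := balG A Q Q1.
(* Triples [(u, n, m)] such that [u] sends [n] to [m] up to [Q]. *)
pose moved (t : G * G * G) := [/\ A t.1.2, A t.2, t.1.2 <> t.2 &
  Q (t.2^-1 * t.1.1 * t.1.2)].
have /choice[step stepP] : forall U, exists t : G * G * G, nbhs (1 : G) U ->
    [/\ V0 t.1.1, U t.1.1 & moved t].
  move=> U; have [U1|nU] := pselect (nbhs (1 : G) U); last by exists (1, 1, 1).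
  apply: contrapT => noT; apply: nthin.
  exists (V0 `&` (U `&` UA)); first by do 2 apply: filterI => //.
  move=> a Aa _ [u [V0u [Uu UAu]] <-]; apply: contrapT => nV; apply: noT.
  have [m Am Qm] := UAP u a UAu Aa; exists (u, a, m) => _; split => //.
  split => //= am; apply: nV; rewrite -am in Qm.
  by have := (Q4 _ _ _ _ Qm Qe Qe Qe).2; rewrite !gsimp.
(* Later choices are made among the elements fixing [n] and [m] up to [Q]. *)
pose shrink U := U `&` ([set x | Q ((step U).1.2^-1 * x * (step U).1.2)] `&`
  [set x | Q ((step U).2^-1 * x * (step U).2)]).
pose N k := iter k shrink setT.
have N1 k : nbhs (1 : G) (N k).
  elim: k => [|k IH]; first exact: filterT.
  by apply: filterI => //; apply: filterI; exact: nbhs1_conj.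
have Nsub k l : (k <= l)%N -> N l `<=` N k.
  move=> /subnK <-; elim: (l - k)%N => [|j IH] //; rewrite addSn.
  by move=> x [/IH].
pose u k := (step (N k)).1.1; pose n k := (step (N k)).1.2.
pose m k := (step (N k)).2.
have V0u k : V0 (u k) by have [] := stepP _ (N1 k).
have An k : A (n k) by have [_ _ []] := stepP _ (N1 k).
have Am k : A (m k) by have [_ _ []] := stepP _ (N1 k).
have nm k : n k <> m k by have [_ _ []] := stepP _ (N1 k).
have Qmun k : Q ((m k)^-1 * u k * n k) by have [_ _ []] := stepP _ (N1 k).
have fixed k l : (k < l)%N ->
    Q ((n k)^-1 * u l * n k) /\ Q ((m k)^-1 * u l * m k).
  move=> kl; have [_ Nul _] := stepP _ (N1 l).
  by have [_ []] := Nsub _ _ kl _ Nul.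
have n_neq_m k l : n l <> m k.
  case: (ltngtP k l) => [kl|lk|->] // nlmk.
  - have [_ fixm] := fixed _ _ kl; rewrite -nlmk in fixm.
    apply: (nm l); apply: sepA => //; have := Qmun l.
    by move=> /QV /(Q4 _ _ _ _ fixm) /(_ Qe Qe)[+ _]; rewrite !gsimp.
  - have [fixn _] := fixed _ _ lk; rewrite nlmk in fixn.
    apply: (nm k); apply: sepA => //; have := Qmun k.
    by move=> /QV /Q4 /(_ fixn Qe Qe)[+ _]; rewrite !gsimp.
have [U U1 UP] := balG (range n) Q Q1.
have [k [l [kl]]] := recG u V0u _ (nbhs1_inv U1).
rewrite /= !gsimp => Ukl.
have [_ [j _ <-] Qj] := UP _ (n k) Ukl (ex_intro2 _ _ k I erefl).
apply: (n_neq_m k j); apply: sepA => //.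
have [_ fixm] := fixed _ _ kl.
have [+ _] := Q4 _ _ _ _ Qj (QV _ (Qmun k)) fixm Qe.
by rewrite !gsimp.
Qed.

End ThinSets.

Theorem theorem1p1 (R : realType) (G : topologicalGroupType)
    (hausG : hausdorff_space G) (fsinG : FSIN R G)
    (A : set G) (countA : countable A) (discA : left_unif_discrete A) :
  right_thin A.
Proof.
have balG := FSIN_proximally_balanced fsinG.
case: (left_unif_discrete_separated discA) => O O1 sepA.
have [|not_rec] := pselect (exists2 V : set G, nbhs (1 : G) V &
    forall d : nat -> G, (forall k, V (d k)) -> forall W, nbhs (1 : G) W ->
    exists k l, (k < l)%N /\ W ((d k)^-1 * d l)).
  by move=> [V0 V01 rec]; exact: (right_thin_recurrent balG O1 sepA V01 rec).
apply: (right_thin_scattered balG countA O1 sepA) => V V1.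
apply: contrapT => not_scat; apply: not_rec; exists V => // d dV W W1.
apply: contrapT => not_close; apply: not_scat; exists d, W; split => // k l kl.
by move=> Wkl; apply: not_close; exists k, l.
Qed.
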